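(* For all integers $r\geq 2$ and $n\geq 1$, $$R_r(S_{n,n})\leq \left(r-\tfrac{1}{2}\right)(2n+2)-1.$$
   Context: For nonnegative integers $k,l$, the double star $S_{k,l}$ is the tree obtained by joining by an edge the centers of two vertex-disjoint stars having $k$ and $l$ leaves respectively; so $|V(S_{k,l})|=k+l+2$. The balanced double star is $S_{n,n}$. For a graph $G$ and positive integer $r$, $R_r(G)$ denotes the smallest integer $N$ such that in every coloring of the edges of the complete graph $K_N$ with $r$ colors there is a monochromatic copy of $G$ (i.e. a subgraph isomorphic to $G$ all of whose edges have the same color). *)

(* Defs.v *)
From mathcomp Require Import all_boot.

Set Implicit Arguments.
Unset Strict Implicit.
Unset Printing Implicit Defensive.

Record sgraph := SGraph {
  vertex : finType;
  adj : rel vertex;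
  adj_sym : symmetric adj;
  adj_irr : irreflexive adj }.

(* Subgraph containment (not necessarily induced): an injective map of the
   vertices that sends edges to edges. *)
Definition contains (G : sgraph) (U : finType) (h : rel U) : bool :=
  [exists f : {ffun vertex G -> U},
     injectiveb f && [forall u, forall v, adj u v ==> h (f u) (f v)]].

Definition Kedge (N : nat) := {e : {set 'I_N} | #|e| == 2}.

Definition color_class (r N : nat) (c : {ffun Kedge N -> 'I_r}) (i : 'I_r) :
    rel 'I_N :=
  fun x y => [exists e : Kedge N, (val e == [set x; y]) && (c e == i)].

Definition forces_mono (r : nat) (G : sgraph) (N : nat) : bool :=
  [forall c : {ffun Kedge N -> 'I_r},
     [exists i : 'I_r, contains G (color_class c i)]].

(* Ramsey's theorem for r colors, which makes the least N below well defined.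
   First, greedily extract a sequence of (vertex, color) pairs in which every
   vertex is joined to all later ones in its own color. *)
Lemma greedy_sequence (r k : nat) : exists N : nat,
  forall (U : finType) (h : 'I_r -> rel U),
    (forall x y, x != y -> exists i, h i x y) ->
  forall A : {set U}, N <= #|A| -> exists s : seq (U * 'I_r),
    [/\ size s = k, uniq (map fst s), {subset map fst s <= A}
      & pairwise (fun p q => h p.2 p.1 q.1) s].
Proof.
elim: k => [|k [N IH]]; first by exists 0 => U h _ A _; exists [::].
exists (r * N).+2 => U h hP A leA.
have /card_gt0P[x xA] : 0 < #|A| by apply: leq_trans leA.
pose B i := [set y in A :\ x | h i x y].
have [i leB] : exists i, N <= #|B i|.
  apply/existsP; apply: contraT; rewrite negb_exists => /forallP ltB.
  have cardA : (r * N).+1 <= #|A :\ x|.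
    by move: leA; rewrite (cardsD1 x A) xA add1n ltnS.
  have sub : A :\ x \subset \bigcup_i B i.
    apply/subsetP => y yA; have /hP[i hi] : x != y.
      by move: yA; rewrite !inE eq_sym => /andP[].
    by apply/bigcupP; exists i => //; rewrite inE yA hi.
  have leU : #|\bigcup_i B i| <= \sum_i #|B i|.
    elim/big_ind2: _ => [|a P b Q le1 le2|//]; first by rewrite cards0.
    by apply: leq_trans (leq_card_setU _ _) _; apply: leq_add.
  have leS : \sum_i #|B i| <= r * N.
    rewrite -[X in X * N](card_ord r) -sum_nat_const.
    by apply: leq_sum => i _; move: (ltB i); rewrite -ltnNge => /ltnW.
  have := leq_trans cardA (leq_trans (subset_leq_card sub) (leq_trans leU leS)).
  by rewrite ltnn.
have [s [sz us ss ps]] := IH U h hP (B i) leB.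
have sB y : y \in map fst s -> [/\ y != x, y \in A & h i x y].
  by move/ss; rewrite !inE => /andP[/andP[]].
exists ((x, i) :: s); split => /=; first by rewrite sz.
- by rewrite us andbT; apply/negP => /sB[]; rewrite eqxx.
- by move=> y; rewrite inE => /predU1P[->//|/sB[]].
- rewrite ps andbT; apply/allP => q qs /=.
  by have [] := sB q.1 (map_f _ qs).
Qed.

Lemma ramsey_exists (r : nat) (G : sgraph) : exists N, forces_mono r G N.
Proof.
set m := #|vertex G|; have [N NP] := greedy_sequence r (r * m).+1.
exists N; apply/forallP => c.
have hP x y : x != y -> exists i, color_class c i x y.
  move=> xy; have e2 : #|[set x; y]| == 2 by rewrite cards2 xy.
  by exists (c (Sub [set x; y] e2)); apply/existsP; exists (Sub [set x; y] e2);
     rewrite /= !eqxx.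
have symc i : symmetric (color_class c i).
  by move=> x y; rewrite /color_class setUC.
have [|s [sz us _ ps]] := NP _ _ hP [set: 'I_N].
  by rewrite cardsT card_ord.
have [i lei] : exists i, m <= count (fun p => p.2 == i) s.
  apply/existsP; apply: contraT; rewrite negb_exists => /forallP lti.
  have szE : size s = \sum_(i < r) count (fun p => p.2 == i) s.
    elim: s {sz us ps lti} => [|p s IHs] /=; first by rewrite big1.
    by rewrite big_split -IHs /= (bigD1 p.2) //= eqxx big1 ?addn0 // => i;
       rewrite eq_sym => /negPf->.
  have : size s <= r * m.
    rewrite szE -[X in X * m](card_ord r) -sum_nat_const.
    by apply: leq_sum => i _; move: (lti i); rewrite -ltnNge => /ltnW.
  by rewrite sz ltnn.
apply/existsP; exists i; set s' := [seq p <- s | p.2 == i].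
have sz' : m <= size s' by rewrite size_filter.
have us' : uniq (map fst s').
  by apply: subseq_uniq us; apply/map_subseq/filter_subseq.
pose t := map fst s'; have szt : m <= size t by rewrite size_map.
have pt : pairwise (color_class c i) t.
  have all_i : all (fun p => p.2 == i) s' by apply: filter_all.
  have : pairwise (fun p q => color_class c p.2 p.1 q.1) s'.
    by apply: subseq_pairwise ps; apply: filter_subseq.
  rewrite pairwise_map; elim: (s') all_i => //= p l IHl.
  by move=> /andP[/eqP-> /IHl{}IHl] /andP[-> /IHl].
have [x0 _] : exists x0 : 'I_N, true by case: (s) sz => // p; exists p.1.
have lt_t (u : vertex G) : enum_rank u < size t.
  exact: leq_trans (ltn_ord _) szt.
apply/existsP; exists [ffun u => nth x0 t (enum_rank u)]; apply/andP; split.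
  apply/injectiveP => u v; rewrite !ffunE => /eqP.
  by rewrite nth_uniq // => /eqP/ord_inj/enum_rank_inj.
apply/forallP => u; apply/forallP => v; apply/implyP => uv; rewrite !ffunE.
have /pairwiseP pt' := pt.
case: (ltngtP (enum_rank u) (enum_rank v)) => [lt|lt|/ord_inj/enum_rank_inj E].
- by apply: (pt' x0); rewrite ?inE.
- by rewrite symc; apply: (pt' x0); rewrite ?inE.
- by move: uv; rewrite E adj_irr.
Qed.

Definition ramsey (r : nat) (G : sgraph) : nat := ex_minn (ramsey_exists r G).

(* The star with k leaves: None is the center, Some i are the leaves. *)
Definition star_adj (k : nat) : rel (option 'I_k) :=
  fun x y => (x == None) != (y == None).

Definition double_star_adj (k l : nat) : rel (option 'I_k + option 'I_l) :=
  fun x y => match x, y with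
  | inl a, inl b => star_adj a b
  | inr a, inr b => star_adj a b
  | inl a, inr b => (a == None) && (b == None)
  | inr a, inl b => (a == None) && (b == None)
  end.

Lemma double_star_sym (k l : nat) : symmetric (@double_star_adj k l).
Proof.
by move=> [a|a] [b|b] /=; rewrite /star_adj 1?eq_sym // andbC.
Qed.

Lemma double_star_irr (k l : nat) : irreflexive (@double_star_adj k l).
Proof. by move=> [a|a]; rewrite /= /star_adj eqxx. Qed.

Definition double_star (k l : nat) : sgraph :=
  SGraph (@double_star_sym k l) (@double_star_irr k l).

Lemma card_double_star (k l : nat) : #|vertex (double_star k l)| = k + l + 2.
Proof. by rewrite card_sum !card_option !card_ord addSn addnS addn2. Qed.

(* Main.v *)
(** Suppose that an [r]-colouring of the complete graph on [N = (2r-1)(n+1)-1]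
    vertices has no monochromatic double star. If an edge [uv] of colour [i] has
    both colour-[i] degrees above [n], then [N_i(u)] and [N_i(v)] together have
    at most [2n+1] elements. In particular the colour-[i] neighbours of a vertex
    of colour-[i] degree above [2n] have colour-[i] degree at most [n], and double
    counting the edges between such vertices shows that all colour degrees lie
    in [n+1, 2n]. Write [s_i(v) = 2n - d_i(v)]; these deficits sum to
    [S = n+3-2r] at every vertex.

    The union bound now says that a colour class is close to a disjoint union of
    cliques: for [i <> k] the set [A = N_i(u) :&: N_k(x)] satisfies
    [#|A| <= 1 + s_i(y) + s_k(y)] for every [y] in [A], so that
    [\sum_(y in A) (2b - 1 - s_i(y) - s_k(y)) <= 2b #|A| - #|A|^2 <= b^2] for
    every [b]. Summing over all [u], [x], [i], [k] bounds a weighted number of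
    two-coloured cherries [u - y - x] from above, whereas the degrees bound it
    from below; with [b = 1 + 2S/r] the two bounds contradict each other when
    [r >= 3]. For [r = 2] the same count with constant weights suffices. *)

Require Import Defs.
From mathcomp Require Import all_boot all_order all_algebra.
From mathcomp Require Import ring lra zify.

Set Implicit Arguments.
Unset Strict Implicit.
Unset Printing Implicit Defensive.

(** * Finding a double star in a graph *)

Lemma exists_subset_card (T : finType) (A : {set T}) k :
  k <= #|A| -> exists2 B : {set T}, B \subset A & #|B| = k.
Proof.
case/card_geqP=> s [us <- sA]; exists [set x in s].
  by apply/subsetP=> x; rewrite inE => /sA.
by rewrite cardsE; apply/card_uniqP.
Qed.

(** Taking [A] inside [X :\: Y] as far as possible spares [Y]: either [A] misses [Y], or [A]
    contains [X :\: Y], and then [A] and [Y :\: A] cover the union. *)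
Lemma exists_disjoint_subsets (T : finType) (X Y : {set T}) k l :
    k <= #|X| -> l <= #|Y| -> k + l <= #|X :|: Y| ->
  exists A B : {set T},
    [/\ A \subset X, B \subset Y, [disjoint A & B], #|A| = k & #|B| = l].
Proof.
move=> kX lY klXY; case: (leqP k #|X :\: Y|) => [kD|Dk].
  have [A AD <-] := exists_subset_card kD; have [B BY <-] := exists_subset_card lY.
  have [AX dAY] : A \subset X /\ [disjoint A & Y].
    by apply/andP; rewrite -subsetD.
  by exists A, B; split=> //; apply: disjointWr dAY.
have kI : k - #|X :\: Y| <= #|X :&: Y| by rewrite leq_subLR addnC cardsID.
have [C CI cardC] := exists_subset_card kI.
pose A := (X :\: Y) :|: C.
have cardA : #|A| = k.
  rewrite cardsU cardC (_ : _ :&: C = set0) ?cards0; first by lia.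
  apply/setP=> x; rewrite !inE; have := subsetP CI x; rewrite !inE.
  by case: (x \in C) => [/(_ isT)/andP[_ ->]|_]; rewrite ?andbF.
have AX : A \subset X.
  by rewrite subUset subsetDl (subset_trans CI) ?subsetIl.
have lD : l <= #|Y :\: A|.
  have sub : X :|: Y \subset A :|: (Y :\: A).
    apply/subsetP=> x; rewrite !inE.
    by case: (x \in X) (x \in Y) (x \in C) => [] [] [].
  have := leq_trans (subset_leq_card sub) (leq_card_setU _ _).
  by rewrite cardA; lia.
have [B BD <-] := exists_subset_card lD.
have [BY dBA] : B \subset Y /\ [disjoint B & A] by apply/andP; rewrite -subsetD.
by exists A, B; split; rewrite // disjoint_sym.
Qed.

Import Order.TTheory GRing.Theory Num.Theory.

Definition nbhd (U : finType) (h : rel U) (u : U) := [set w | h u w].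

(** The leaves are disjoint subsets of [nbhd h u :\ v] and [nbhd h v :\ u]; the [+ 2] accounts for
    the two centres, which both lie in the union. *)
Lemma contains_double_star (U : finType) (h : rel U) (k l : nat) (u v : U) :
    symmetric h -> irreflexive h -> h u v ->
    k < #|nbhd h u| -> l < #|nbhd h v| ->
    k + l + 2 <= #|nbhd h u :|: nbhd h v| ->
  contains (double_star k l) h.
Proof.
move=> symh irrh huv ku lv kluv.
have uv : u != v by apply: contraTneq huv => ->; rewrite irrh.
have vNu : v \in nbhd h u by rewrite inE.
have uNv : u \in nbhd h v by rewrite inE symh.
have [A [B [AX BY dAB cardA cardB]]] :
  exists A B : {set U}, [/\ A \subset nbhd h u :\ v, B \subset nbhd h v :\ u,
    [disjoint A & B], #|A| = k & #|B| = l].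
  apply: exists_disjoint_subsets.
  - by move: ku; rewrite (cardsD1 v) vNu.
  - by move: lv; rewrite (cardsD1 u) uNv.
  have sub : nbhd h u :|: nbhd h v \subset
      [set u; v] :|: ((nbhd h u :\ v) :|: (nbhd h v :\ u)).
    apply/subsetP=> x; rewrite !inE.
    by case: (x == u) (x == v) (h u x) (h v x) => [] [] [] [].
  have := leq_trans (subset_leq_card sub) (leq_card_setU _ _).
  by rewrite cards2 uv; lia.
pose a (i : 'I_k) := nth u (enum A) i; pose b (i : 'I_l) := nth v (enum B) i.
have aA i : a i \in A by rewrite -mem_enum mem_nth // -cardE cardA.
have bB i : b i \in B by rewrite -mem_enum mem_nth // -cardE cardB.
have a_inj : injective a.
  move=> i j /eqP; rewrite nth_uniq ?enum_uniq -?cardE ?cardA //.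
  by move/eqP/val_inj.
have b_inj : injective b.
  move=> i j /eqP; rewrite nth_uniq ?enum_uniq -?cardE ?cardB //.
  by move/eqP/val_inj.
have aP i : [/\ a i != v, h u (a i) & a i != u].
  have := subsetP AX _ (aA i); rewrite !inE => /andP[-> hua]; split=> //.
  by apply: contraTneq hua => ->; rewrite irrh.
have bP i : [/\ b i != u, h v (b i) & b i != v].
  have := subsetP BY _ (bB i); rewrite !inE => /andP[-> hvb]; split=> //.
  by apply: contraTneq hvb => ->; rewrite irrh.
have abP i j : a i != b j.
  by apply: contraTneq (aA i) => ->; rewrite (disjointFl dAB (bB j)).
pose f (x : option 'I_k + option 'I_l) :=
  match x with
  | inl None => u | inl (Some i) => a i
  | inr None => v | inr (Some i) => b i
  end.
have f_inj : injective f.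
  move=> [[i|]|[i|]] [[j|]|[j|]] //= E; do ?by rewrite ?(a_inj _ _ E) ?(b_inj _ _ E).
  all: do ?[by case: (aP i); rewrite E eqxx | by case: (bP i); rewrite E eqxx].
  all: do ?[by case: (aP j); rewrite -E eqxx | by case: (bP j); rewrite -E eqxx].
  - by case/eqP: (abP i j).
  - by rewrite E eqxx in uv.
  - by case/eqP: (abP j i).
  - by rewrite E eqxx in uv.
apply/existsP; exists [ffun x => f x]; apply/andP; split.
  by apply/injectiveP=> x y; rewrite !ffunE; apply: f_inj.
apply/forallP=> x; apply/forallP=> y; apply/implyP; rewrite !ffunE.
case: x y => [[i|]|[i|]] [[j|]|[j|]] //= _.
- by rewrite symh; case: (aP i).
- by case: (aP j).
- by rewrite symh; case: (bP i).
- by rewrite symh.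
- by case: (bP j).
Qed.

(** * Power-sum inequalities for colour degrees *)

Lemma sum_le_sqr (T : finType) (A : {set T}) (F : T -> rat) (b : rat) :
  (forall y, y \in A -> F y <= 2%:R * b - #|A|%:R)%R ->
  (\sum_(y in A) F y <= b ^+ 2)%R.
Proof.
move=> le_F; apply: (@le_trans _ _ (\sum_(y in A) (2%:R * b - #|A|%:R))%R).
  exact: ler_sum.
rewrite sumr_const -mulr_natr; have := sqr_ge0 (b - #|A|%:R)%R.
by rewrite !expr2; lra.
Qed.

Lemma sum_neq_const (T : finType) (c : rat) :
  (\sum_(u : T) \sum_(x | x != u) c = #|T|%:R * (#|T|.-1)%:R * c)%R.
Proof.
under eq_bigr => u _ do rewrite sumr_const cardC1.
by rewrite sumr_const -mulrnA mulnC -natrM mulr_natl.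
Qed.

Local Open Scope ring_scope.

Lemma sum_offdiag (R : comNzRingType) (r : nat) (d : 'I_r -> R) (K : R) :
  \sum_i \sum_(k | k != i) d i * d k * (K + d i + d k) =
  K * (\sum_i d i) ^+ 2 + (2%:R * \sum_i d i - K) * (\sum_i d i ^+ 2)
  - 2%:R * \sum_i d i ^+ 3.
Proof.
set P := \sum_i d i; set D2 := \sum_i d i ^+ 2.
transitivity (\sum_i (K * P * d i + P * d i ^+ 2 + D2 * d i
                      - (K * d i ^+ 2 + 2%:R * d i ^+ 3))).
  apply: eq_bigr => i _.
  have -> : \sum_(k | k != i) d i * d k * (K + d i + d k)
    = \sum_k d i * d k * (K + d i + d k) - d i * d i * (K + d i + d i).
    by rewrite [in RHS](bigD1 i) //= addrC addrK.
  have -> : \sum_k d i * d k * (K + d i + d k)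
      = (K * d i + d i ^+ 2) * P + d i * D2.
    rewrite !mulr_sumr -big_split; apply: eq_bigr => k _ /=; ring.
  by ring.
rewrite !(sumrB, big_split) /= -!mulr_sumr -/P -/D2; ring.
Qed.

Lemma sum_offdiag1 (R : comNzRingType) (r : nat) (d : 'I_r -> R) :
  \sum_i \sum_(k | k != i) d i * d k = (\sum_i d i) ^+ 2 - \sum_i d i ^+ 2.
Proof.
rewrite expr2 mulr_suml -sumrB; apply: eq_bigr => i _.
by rewrite mulr_sumr [in RHS](bigD1 i) //= expr2 addrAC subrr add0r.
Qed.

Lemma sum_ord_const (R : nzRingType) (r : nat) (x : R) :
  \sum_(i < r) x = x * r%:R.
Proof. by rewrite sumr_const card_ord mulr_natr. Qed.

(** Cauchy-Schwarz for two terms, written as a variance around [P / 2], makes the sum of squares at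
    least [P ^+ 2 / 2]. *)
Lemma sum_offdiag1_gap (R : realFieldType) (r : nat) (d : 'I_r -> R) (n P : R) :
    r%:R = 2 :> R -> \sum_i d i = P -> 0 < P -> 8 * n < 3 * P ->
  2 * (\sum_i d i * (2 * n - d i)) < \sum_i \sum_(k | k != i) d i * d k.
Proof.
move=> r2 sum_d P_gt0 nP; rewrite sum_offdiag1 sum_d.
have -> : \sum_i d i * (2 * n - d i) = 2 * n * P - \sum_i d i ^+ 2.
  by rewrite -sum_d mulr_sumr -sumrB; apply: eq_bigr => i _; ring.
have : 0 <= \sum_i (d i - P / 2) ^+ 2.
  by apply: sumr_ge0 => i _; apply: sqr_ge0.
have -> : \sum_i (d i - P / 2) ^+ 2 = \sum_i (d i ^+ 2 - P * d i + P ^+ 2 / 4).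
  by apply: eq_bigr => i _; field.
rewrite !(big_split, sumrN) /= -!mulr_sumr sum_d sum_ord_const r2; nra.
Qed.

(* [r ^+ 2] times the difference of the two sides is a polynomial in [t = r - 3],
   [S = n + 3 - 2 r] and the second and third moments [q], [c] of the deficits
   [2 n - d i] all of whose coefficients are nonnegative. *)
Lemma moment_gap (R : realFieldType) (t S q c r n P D2 D3 b : R) :
    0 <= t -> 0 <= S -> 0 <= q -> 0 <= c ->
    r = t + 3 -> n = S + 2 * r - 3 -> P = 2 * r * n - S -> r * b = r + 2 * S ->
    D2 = 4 * n * P - 4 * n ^+ 2 * r + q ->
    D3 = 8 * n ^+ 3 * r - 12 * n ^+ 2 * P + 6 * n * D2 - c ->
  P * (b ^+ 2 * ((r - 1) * (r - 2) + 2)) <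
  (2 * b - 1 - 4 * n) * P ^+ 2 + (2 * P - (2 * b - 1 - 4 * n)) * D2 - 2 * D3.
Proof.
move=> t0 S0 q0 c0 rE nE PE bE D2E D3E.
have r_gt0 : 0 < r by lra.
rewrite -subr_gt0 -(pmulr_rgt0 _ (exprn_gt0 2 r_gt0)).
set gap := (X in 0 < X).
have -> : gap = r * ((2 * (r * b) - r - 4 * n * r) * P ^+ 2
    + (2 * r * P - (2 * (r * b) - r - 4 * n * r)) * D2 - 2 * r * D3)
    - (r * b) ^+ 2 * (P * ((r - 1) * (r - 2) + 2)) by rewrite /gap; ring.
have -> : r * ((2 * (r * b) - r - 4 * n * r) * P ^+ 2
    + (2 * r * P - (2 * (r * b) - r - 4 * n * r)) * D2 - 2 * r * D3)
    - (r * b) ^+ 2 * (P * ((r - 1) * (r - 2) + 2))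
  = 1296 + (3942 * t + 4752 * t ^+ 2 + 2928 * t ^+ 3 + 980 * t ^+ 4
             + 170 * t ^+ 5 + 12 * t ^+ 6
    + (1332 + 3525 * t + 3463 * t ^+ 2 + 1601 * t ^+ 3 + 353 * t ^+ 4
       + 30 * t ^+ 5) * S
    + (309 + 682 * t + 481 * t ^+ 2 + 132 * t ^+ 3 + 12 * t ^+ 4) * S ^+ 2
    + (16 + 24 * t + 8 * t ^+ 2) * S ^+ 3
    + (18 + 12 * t + 2 * t ^+ 2) * c
    + (99 + 246 * t + 203 * t ^+ 2 + 68 * t ^+ 3 + 8 * t ^+ 4) * q
    + (6 + 44 * t + 26 * t ^+ 2 + 4 * t ^+ 3) * (S * q)).
  by rewrite bE D3E D2E PE nE rE; ring.
apply: ltr_pwDl; first by rewrite ltr0n.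
by do ?[rewrite ler0n | exact: exprn_ge0 | assumption
     | apply: mulr_ge0 | apply: addr_ge0].
Qed.

(** This is what contradicts [cherry_bound], at a single vertex: the [d i] are its colour degrees
    and [S] is its total deficit. *)
Lemma sum_offdiag_gap (R : realFieldType) (r n : nat) (d : 'I_r -> R) (P : R)
    (S := n%:R + 3 - 2 * r%:R) :
    (3 <= r)%N -> (forall i, 0 <= d i <= 2 * n%:R) -> \sum_i d i = P ->
    P = 2 * r%:R * n%:R - S ->
  P * ((1 + 2 * S / r%:R) ^+ 2 * ((r - 1) * (r - 2) + 2)%:R) <
  \sum_i \sum_(k | k != i)
     d i * d k * (2 * (1 + 2 * S / r%:R) - 1 - 4 * n%:R + d i + d k).
Proof.
move=> r3 d_le sum_d PE; rewrite sum_offdiag sum_d.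
have r_ne0 : r%:R != 0 :> R by rewrite pnatr_eq0; lia.
have r3R : 3 <= r%:R :> R by rewrite ler_nat.
rewrite natrD natrM !natrB ?(leq_trans _ r3) //.
apply: (@moment_gap _ (r%:R - 3) S (\sum_i (2 * n%:R - d i) ^+ 2)
                    (\sum_i (2 * n%:R - d i) ^+ 3)).
- lra.
- have : P <= 2 * n%:R * r%:R.
    by rewrite -sum_d -sum_ord_const; apply: ler_sum => i _; case/andP: (d_le i).
  by rewrite PE; lra.
- by apply: sumr_ge0 => i _; apply: sqr_ge0.
- by apply: sumr_ge0 => i _; rewrite exprn_ge0 // subr_ge0; case/andP: (d_le i).
- by rewrite subrK.
- by rewrite /S; ring.
- by [].
- by field.
- have -> : \sum_i (2 * n%:R - d i) ^+ 2
     = \sum_i (4 * n%:R ^+ 2 - 4 * n%:R * d i + d i ^+ 2).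
    by apply: eq_bigr => i _; ring.
  by rewrite !(big_split, sumrN) /= -!mulr_sumr sum_ord_const sum_d; ring.
- have -> : \sum_i (2 * n%:R - d i) ^+ 3
     = \sum_i (8 * n%:R ^+ 3 - 12 * n%:R ^+ 2 * d i + 6 * n%:R * d i ^+ 2 - d i ^+ 3).
    by apply: eq_bigr => i _; ring.
  by rewrite !(big_split, sumrN) /= -!mulr_sumr sum_ord_const sum_d; ring.
Qed.

Local Close Scope ring_scope.

(** * Colour degrees and near-cliques *)

Section Coloring.

Variables (V : finType) (r n : nat) (col : V -> V -> 'I_r).
Hypothesis colC : forall x y, col x y = col y x.

Definition cnb (i : 'I_r) (u : V) := [set w | (w != u) && (col u w == i)].

Lemma cnbC i u w : (w \in cnb i u) = (u \in cnb i w).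
Proof. by rewrite !inE eq_sym colC. Qed.

Lemma cnb_self u w : w != u -> w \in cnb (col u w) u.
Proof. by rewrite !inE eqxx andbT. Qed.

Lemma cnb_irr i u : u \notin cnb i u.
Proof. by rewrite inE eqxx. Qed.

Lemma sum_cnb u : \sum_i #|cnb i u| = #|V|.-1.
Proof.
rewrite -cardsT (cardsD1 u) inE /= -sum1_card.
rewrite (partition_big (col u) xpredT) //=; apply: eq_bigr => i _.
by rewrite -sum1_card; apply: eq_bigl => w; rewrite !inE andbT.
Qed.

Hypotheses (r_ge2 : 2 <= r) (n_gt0 : 0 < n).
(** Subtraction-free form of [#|V| = (2r - 1)(n + 1) - 1]. *)
Hypothesis cardV : #|V|.-1 + n + 3 = 2 * r * n + 2 * r.
Hypothesis cnb_union : forall i u w, w \in cnb i u ->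
  n < #|cnb i u| -> n < #|cnb i w| -> #|cnb i u :|: cnb i w| <= (2 * n).+1.

Lemma degree_range i u : n < #|cnb i u| <= 2 * n.
Proof.
pose lo i u := #|cnb i u| <= n; pose hi i u := 2 * n < #|cnb i u|.
(* Otherwise the union would contain [v] besides the at least [2n + 1] elements of [cnb j v]. *)
have hi_lo j v w : hi j v -> w \in cnb j v -> lo j w.
  move=> hiv wv; rewrite /lo leqNgt; apply/negP=> low.
  have := cnb_union wv (leq_ltn_trans _ hiv) low; rewrite leq_pmull // => /(_ isT).
  apply/negP; rewrite -ltnNge (cardsD1 v) inE -cnbC wv orbT add1n ltnS.
  apply: leq_trans hiv (subset_leq_card _); apply/subsetP=> x xv.
  by rewrite in_setD1 inE xv andbT; move: xv; rewrite !inE => /andP[].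
have sum_hi_lo : \sum_v \sum_(j | hi j v) #|cnb j v|
    <= \sum_w \sum_(j | lo j w) #|cnb j w|.
  under eq_bigr do under eq_bigr do rewrite -sum1_card.
  under [X in _ <= X]eq_bigr do under eq_bigr do rewrite -sum1_card.
  rewrite (exchange_big_dep xpredT) //= [X in _ <= X](exchange_big_dep xpredT) //=.
  apply: leq_sum => j _; rewrite (exchange_big_dep (lo j)) /=; last exact: hi_lo.
  apply: leq_sum => w _; rewrite !sum1_card; apply/subset_leq_card/subsetP=> v.
  by rewrite unfold_in => /andP[_]; rewrite cnbC.
have sum_but_one (F : 'I_r -> nat) j0 m :
    (forall j, F j <= 2 * n) -> F j0 <= m -> \sum_j F j <= m + 2 * n * r.-1.
  move=> F2n Fm; rewrite (bigD1 j0) //=; apply: leq_add => //.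
  rewrite mulnC -[in X in _ <= X](card_ord r) -(cardC1 j0) -sum_nat_const.
  by apply: leq_sum => j _.
(* The neighbours counted in [hi] degrees are counted again in [lo] degrees by
   [sum_hi_lo], but at each single vertex the [hi] degrees dominate. *)
have local v : (forall j, n < #|cnb j v| <= 2 * n) \/
    \sum_(j | lo j v) #|cnb j v| < \sum_(j | hi j v) #|cnb j v|.
  case: (pickP (hi^~ v)) => [j0 hij0|nhi]; [right | left].
    (* [e] balances the identity below. Each [e j] is at most [2n] and [e j0] is 0, so their sum
       stays below the degree sum [#|V|.-1]. *)
    pose e j := if hi j v then 0 else if lo j v then 2 * #|cnb j v| else #|cnb j v|.
    have : \sum_j #|cnb j v| + \sum_(j | lo j v) #|cnb j v|
         = \sum_(j | hi j v) #|cnb j v| + \sum_j e j.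
      rewrite [X in _ + X = _]big_mkcond [X in _ = X + _]big_mkcond -!big_split /=.
      by apply: eq_bigr => j _; rewrite /e /hi /lo; do 2!case: ifP; lia.
    have : \sum_j e j <= 0 + 2 * n * r.-1.
      apply: (sum_but_one e j0); last by rewrite /e hij0.
      by move=> j; rewrite /e /hi /lo; do 2?case: ifP; lia.
    by rewrite sum_cnb; nia.
  have le2n j : #|cnb j v| <= 2 * n by rewrite leqNgt; apply/negbT/nhi.
  move=> j; rewrite le2n andbT ltnNge; apply/negP=> loj.
  (* One degree at most [n] would keep the degree sum down to [2rn - n], which is [2r - 3] short of
     [#|V|.-1]. *)
  by have := sum_but_one _ j n le2n loj; rewrite sum_cnb; nia.
case: (local u) => // lt_u.
have le_v v : \sum_(j | lo j v) #|cnb j v| <= \sum_(j | hi j v) #|cnb j v|.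
  case: (local v) => [mid|/ltnW//].
  by rewrite big1 // => j; rewrite /lo leqNgt; case/andP: (mid j) => ->.
have : \sum_v \sum_(j | lo j v) #|cnb j v| < \sum_v \sum_(j | hi j v) #|cnb j v|.
  rewrite (bigD1 u) //= [X in _ < X](bigD1 u) //= -addSn; apply: leq_add => //.
  by apply: leq_sum.
by rewrite ltnNge sum_hi_lo.
Qed.

Lemma edge_union i u w :
  w \in cnb i u -> #|cnb i u :|: cnb i w| <= (2 * n).+1.
Proof.
by move=> wu; apply: cnb_union => //;
  [case/andP: (degree_range i u) | case/andP: (degree_range i w)].
Qed.

(** The union in [edge_union] splits into [u], [cnb i u] and the vertices escaping from the closed
    neighbourhood of [u]; hence at most [s_i(u)] of them escape. *)
Lemma card_cnb_escape i u w : w \in cnb i u ->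
  #|cnb i w :\: (u |: cnb i u)| + #|cnb i u| <= 2 * n.
Proof.
move=> wu; have := edge_union wu.
have -> : cnb i u :|: cnb i w
    = u |: (cnb i u :|: (cnb i w :\: (u |: cnb i u))).
  apply/setP=> x; rewrite !in_setU !in_setD !in_setU !in_set1.
  by have [->|] := eqVneq x u; case: (_ \in cnb i u);
     rewrite // -cnbC wu.
rewrite cardsU1 !in_setU !in_setD setU11 orbF cnb_irr ltnS addnC.
rewrite cardsU (_ : _ :&: _ = set0) ?cards0 ?subn0 //.
apply/setP=> x; rewrite in_setI in_setD in_setU negb_or in_set0.
by case: (x \in cnb i u); rewrite ?andbF.
Qed.

(** Another vertex of the intersection is not joined to [y] in both colours, so it escapes from [y]
    either in colour [i], as a neighbour of [u], or in colour [k], as a neighbour of [x]. *)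
Lemma card_bicolored_codegree i k u x y :
    i != k -> y \in cnb i u :&: cnb k x ->
  #|cnb i u :&: cnb k x| + #|cnb i y| + #|cnb k y| <= (4 * n).+1.
Proof.
move=> ik; rewrite inE => /andP[yu yx].
have sub : cnb i u :&: cnb k x \subset
    y |: ((cnb i u :\: (y |: cnb i y)) :|: (cnb k x :\: (y |: cnb k y))).
  apply/subsetP=> w; rewrite !in_setU !in_setD !in_setU !in_set1 inE.
  case/andP=> -> ->; have [//|wy] := eqVneq w y; rewrite /= !inE wy /= !andbT.
  by rewrite -negb_and; apply: contraNN ik => /andP[/eqP<- /eqP<-].
have := leq_trans (subset_leq_card sub) (leq_card_setU _ _).
have := leq_of_leqif
  (leq_card_setU (cnb i u :\: (y |: cnb i y)) (cnb k x :\: (y |: cnb k y))).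
have := card_cnb_escape (etrans (cnbC i y u) yu : u \in cnb i y).
have := card_cnb_escape (etrans (cnbC k y x) yx : x \in cnb k y).
by rewrite cards1; lia.
Qed.

(** * Weighted count of two-coloured cherries *)

Local Open Scope ring_scope.

Let d (i : 'I_r) (u : V) : rat := #|cnb i u|%:R.

Lemma sum_by_color (F : 'I_r -> rat) y :
  \sum_(u | u != y) F (col y u) = \sum_i d i y * F i.
Proof.
rewrite (partition_big (col y) xpredT) //=; apply: eq_bigr => i _.
rewrite mulr_natl -sumr_const; apply: eq_big => [u|u /andP[_ /eqP-> //]].
by rewrite inE.
Qed.

Lemma sum_swap (T : finType) (F : T -> T -> T -> rat) :
  \sum_y \sum_u \sum_x F y u x = \sum_u \sum_x \sum_y F y u x.
Proof.
by rewrite exchange_big; apply: eq_bigr => u _; rewrite exchange_big.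
Qed.

(* Cherries with centre [y] and ends [u], [x] in different colours, split
   according to whether the colour of [ux] is new, that of [yu], or that of
   [yx]. *)
Lemma bicolored_cherries (g : V -> 'I_r -> 'I_r -> rat) :
    (forall y i k, g y i k = g y k i) ->
  \sum_y \sum_i \sum_(k | k != i) d i y * d k y * g y i k =
  \sum_u \sum_(x | x != u) \sum_(i | i != col u x)
     \sum_(k | (k != col u x) && (k != i))
        \sum_(y in cnb i u :&: cnb k x) g y i k
  + 2%:R * \sum_y \sum_(u | u != y)
     \sum_(x in cnb (col y u) u :\: (y |: cnb (col y u) y))
        g y (col y u) (col y x).
Proof.
move=> gC.
pose cherry y u x := [&& u != y, x != y & col y x != col y u].
pose T (P : 'I_r -> 'I_r -> 'I_r -> bool) y u x :=
  if cherry y u x && P (col u x) (col y u) (col y x)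
  then g y (col y u) (col y x) else 0.
have -> : \sum_y \sum_i \sum_(k | k != i) d i y * d k y * g y i k
        = \sum_y \sum_u \sum_x T (fun _ _ _ => true) y u x.
  apply: eq_bigr => y _.
  transitivity (\sum_(u | u != y) \sum_(x | x != y)
      if col y x != col y u then g y (col y u) (col y x) else 0).
    rewrite (sum_by_color (fun i => \sum_(x | x != y)
      if col y x != i then g y i (col y x) else 0)).
    apply: eq_bigr => i _.
    rewrite (sum_by_color (fun k => if k != i then g y i k else 0)).
    rewrite mulr_sumr big_mkcond; apply: eq_bigr => k _.
    by case: ifP; rewrite ?mulr0 ?mulrA.
  rewrite big_mkcond; apply: eq_bigr => u _.
  case: ifPn => uy; last by rewrite big1 // => x _; rewrite /T /cherry (negPf uy).
  rewrite big_mkcond; apply: eq_bigr => x _.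
  by rewrite /T /cherry uy andbT; case: (x != y).
pose new (j i k : 'I_r) := (j != i) && (j != k).
have -> : \sum_y \sum_u \sum_x T (fun _ _ _ => true) y u x
    = \sum_y \sum_u \sum_x T new y u x
      + (\sum_y \sum_u \sum_x T (fun j i k => j == i) y u x
         + \sum_y \sum_u \sum_x T (fun j i k => j == k) y u x).
  rewrite -!big_split; apply: eq_bigr => y _.
  rewrite -!big_split; apply: eq_bigr => u _.
  rewrite -!big_split; apply: eq_bigr => x _.
  rewrite /T /cherry /new /=.
  case: (u == y); case: (x == y); rewrite ?addr0 //=.
  case: (eqVneq (col y x) (col y u)) => [_|xu]; rewrite ?addr0 //=.
  have [->|ne] := eqVneq (col u x) (col y u).
    by rewrite eq_sym (negPf xu) add0r addr0.
  by case: (col u x == col y x); rewrite ?add0r ?addr0.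
(* Exchanging the ends [u] and [x] turns one kind of repeated colour into the other. *)
have swap : \sum_y \sum_u \sum_x T (fun j i k => j == k) y u x
          = \sum_y \sum_u \sum_x T (fun j i k => j == i) y u x.
  apply: eq_bigr => y _; rewrite exchange_big.
  apply: eq_bigr => u _; apply: eq_bigr => x _.
  rewrite /T /cherry (colC x u) gC andbCA [col y x == _]eq_sym.
  by rewrite (eq_sym (col y u)).
rewrite swap -mulr2n mulr_natl; congr (_ + _ *+ 2); last first.
  apply: eq_bigr => y _; rewrite [RHS]big_mkcond; apply: eq_bigr => u _.
  case: ifPn => uy; last by rewrite big1 // => x _; rewrite /T /cherry (negPf uy).
  rewrite [RHS]big_mkcond; apply: eq_bigr => x _; rewrite /T /cherry uy /=.
  congr (if _ then _ else _); rewrite !inE negb_or negb_and negbK.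
  case: (eqVneq x y) => [->|xy] //=.
  case: (eqVneq x u) => [->|xu] //=.
  by rewrite eqxx.
rewrite sum_swap; apply: eq_bigr => u _.
rewrite [RHS]big_mkcond; apply: eq_bigr => x _.
case: eqVneq => [->|xu] /=.
  by rewrite big1 // => y _; rewrite /T /cherry eqxx !andbF.
rewrite pair_big_dep /= -big_mkcond /=.
rewrite (partition_big (fun y => (col y u, col y x))
   (fun p => (p.1 != col u x) && ((p.2 != col u x) && (p.2 != p.1)))) /=.
  apply: eq_bigr => [[i k]] /= /and3P[ij kj ki].
  apply: eq_big => [y|y].
    rewrite !inE xpair_eqE /cherry /new ![_ == y]eq_sym ![col _ y]colC.
    case: (eqVneq (col y u) i) => [->|]; case: (eqVneq (col y x) k) => [->|];
      rewrite ?andbF //=.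
    by rewrite ki ![col u x == _]eq_sym ij kj !andbT.
  by rewrite xpair_eqE => /andP[_ /andP[/eqP<- /eqP<-]].
move=> y; rewrite /cherry /new /= => /andP[/and3P[_ _ ->] /andP[]].
by rewrite ![col u x == _]eq_sym => -> ->.
Qed.

Lemma card_neq2 (i j : 'I_r) : i != j ->
  #|[pred k | (k != j) && (k != i)]| = (r - 2)%N.
Proof.
move=> ij; have := cardsC [set i; j]; rewrite cards2 ij card_ord /=.
have -> : ~: [set i; j] = [set k | (k != j) && (k != i)].
  by apply/setP=> k; rewrite !inE negb_or andbC.
by rewrite cardsE => E; apply: (@addnI 2); rewrite subnKC.
Qed.

(** By [sum_le_sqr] every inner sum is at most [b ^+ 2]. An ordered pair of distinct vertices has
    [(r - 1) * (r - 2)] such sums with a new colour between the ends, and 2 with a repeated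
    colour. *)
Lemma cherry_bound (b : rat) :
  \sum_y \sum_i \sum_(k | k != i)
     d i y * d k y * (2%:R * b - 1 - 4%:R * n%:R + d i y + d k y)
  <= #|V|%:R * (#|V|.-1)%:R * (b ^+ 2 * (((r - 1) * (r - 2) + 2)%N)%:R).
Proof.
rewrite (bicolored_cherries
  (g := fun y i k => 2%:R * b - 1 - 4%:R * n%:R + d i y + d k y)); last first.
  by move=> y i k; rewrite addrAC.
rewrite natrD mulrDr [in X in _ <= X]mulrDr -!sum_neq_const; apply: lerD.
  apply: ler_sum => u _; apply: ler_sum => x _.
  apply: (@le_trans _ _ (\sum_(i | i != col u x)
      \sum_(k | (k != col u x) && (k != i)) b ^+ 2)).
    apply: ler_sum => i _; apply: ler_sum => k /andP[_ ki].
    apply: sum_le_sqr => y yA; rewrite eq_sym in ki.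
    have := card_bicolored_codegree ki yA.
    rewrite -(ler_nat rat) -[(4 * n).+1]addn1 !natrD /d; lra.
  under eq_bigr => i ij do rewrite sumr_const card_neq2 //.
  by rewrite sumr_const cardC1 card_ord -mulrnA subn1 mulnC mulr_natr.
rewrite mulr_sumr; apply: ler_sum => y _; rewrite mulr_sumr.
apply: ler_sum => u uy; rewrite mulrC ler_wpM2r //.
(* The escape bound controls one colour degree of [y]; the other is merely at most [2n]. *)
apply: sum_le_sqr => x _.
have uN : u \in cnb (col y u) y by rewrite cnb_self.
have := card_cnb_escape uN; have /andP[_] := degree_range (col y x) y.
by rewrite /d -2!(ler_nat rat) natrD natrM; lra.
Qed.

(** With two colours none is left to be new between the ends, so only escaping vertices remain, at
    most [2n - d i y] for each edge of colour [i] at [y]. *)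
Lemma unit_cherry_bound : r = 2 ->
  \sum_y \sum_i \sum_(k | k != i) d i y * d k y
  <= 2%:R * \sum_y \sum_i d i y * (2%:R * n%:R - d i y).
Proof.
move=> r2.
under eq_bigr => y _ do under eq_bigr => i _ do
  under eq_bigr => k _ do rewrite -[d i y * d k y]mulr1.
rewrite (bicolored_cherries (g := fun _ _ _ => 1)) // big1 ?add0r; last first.
  move=> u _; rewrite big1 // => x _; rewrite big1 // => i ij.
  rewrite big_pred0 // => k; have := card_neq2 ij.
  by rewrite [X in _ = (X - 2)%N]r2 => /card0_eq/(_ k).
rewrite ler_wpM2l //; apply: ler_sum => y _.
rewrite -(sum_by_color (fun i => 2%:R * n%:R - d i y)); apply: ler_sum => u uy.
have uN : u \in cnb (col y u) y by rewrite cnb_self.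
have := card_cnb_escape uN; rewrite sumr_const /d.
by rewrite -(ler_nat rat) natrD natrM; lra.
Qed.

Lemma sum_d y : \sum_i d i y = (#|V|.-1)%:R.
Proof. by rewrite -(sum_cnb y) natr_sum. Qed.

Lemma no_such_coloring : False.
Proof.
pose S : rat := n%:R + 3 - 2 * r%:R.
have PE : (#|V|.-1)%:R = 2 * r%:R * n%:R - S :> rat.
  have := congr1 (fun m => m%:R : rat) cardV.
  by rewrite /= !natrD !natrM /S; lra.
have V_gt0 : has xpredT (index_enum V).
  have : (0 < #|V|)%N by nia.
  by case/card_gt0P=> y _; apply/hasP; exists y; rewrite ?mem_index_enum.
have d_le y i : 0 <= d i y <= 2 * n%:R.
  by rewrite ler0n -natrM ler_nat; case/andP: (degree_range i y).
have [r2|r_ne2] := eqVneq r 2.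
  have := unit_cherry_bound r2; rewrite mulr_sumr; apply/negP; rewrite -ltNge.
  have r2R : r%:R = 2 :> rat by rewrite r2.
  have n0 : 0 <= n%:R :> rat by [].
  (* For [r = 2] the degree sum is [3n + 1], and [8n < 3(3n + 1)]. *)
  apply: ltr_sum => // y _; apply: (@sum_offdiag1_gap _ _ _ _ (#|V|.-1)%:R) => //.
  - exact: sum_d.
  - by rewrite PE /S r2R; lra.
  - by rewrite PE /S r2R; lra.
have r3 : (3 <= r)%N by rewrite ltn_neqAle eq_sym r_ne2.
(* As [S / r] is the average deficit at a vertex, this [b] is the average of the codegree bound
   [1 + s_i + s_k] over all pairs of colours. *)
have := cherry_bound (1 + 2 * S / r%:R); apply/negP; rewrite -ltNge.
set m := _ * (_ ^+ 2 * _); have -> : m = \sum_(y : V)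
    (#|V|.-1)%:R * ((1 + 2 * S / r%:R) ^+ 2 * ((r - 1) * (r - 2) + 2)%:R).
  by rewrite sumr_const /m -mulrA mulr_natl.
apply: ltr_sum => // y _; apply: sum_offdiag_gap => //; exact: sum_d.
Qed.

End Coloring.

(** * From colourings to the Ramsey number *)

Lemma forces_mono_double_star (r n N : nat) : 2 <= r -> 0 < n ->
    N.-1 + n + 3 = 2 * r * n + 2 * r -> forces_mono r (double_star n n) N.
Proof.
move=> r2 n0 NE; apply/forallP=> c; apply: contraT; rewrite negb_exists.
move=> /forallP noS.
pose i0 := Ordinal (ltnW r2).
(* [i0] is a default for the diagonal, which [classE] excludes by [y != x]. *)
pose col (x y : 'I_N) := if insub [set x; y] is Some e then c e else i0.
have colC x y : col x y = col y x by rewrite /col setUC.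
have classE i x y : color_class c i x y = (y != x) && (col x y == i).
  rewrite /color_class /col; apply/existsP/andP=> [[e /andP[/eqP eE ce]]|[yx]].
    rewrite -eE valK ce; split=> //.
    by have := valP e; rewrite /= eE cards2 [y == x]eq_sym; case: (x != y).
  case: insubP => [e _ eE ce|]; first by exists e; rewrite eE eqxx.
  by rewrite cards2 [x == y]eq_sym yx.
have nbhdE i u : nbhd (color_class c i) u = cnb col i u.
  by apply/setP=> w; rewrite !inE classE.
have := @no_such_coloring 'I_N r n col colC r2 n0; rewrite card_ord => /(_ NE).
case=> i u w wu nu nw; rewrite leqNgt; apply: contra (noS i) => big.
apply: (@contains_double_star _ _ _ _ u w); rewrite ?nbhdE //.
- by move=> x y; rewrite !classE eq_sym colC.
- by move=> x; rewrite classE eqxx.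
- by move: wu; rewrite inE classE.
- by move: big; rewrite addn2 mul2n addnn.
Qed.

Local Open Scope ring_scope.

Theorem theorem1p5 (r n : nat) (hr : (2 <= r)%N) (hn : (1 <= n)%N) :
  (ramsey r (double_star n n))%:R
    <= (r%:R - 1 / 2%:R) * (2%:R * n%:R + 2%:R) - 1 :> rat.
Proof.
(* The rational bound is this integer, since [(r - 1/2)(2n + 2) = (2r - 1)(n + 1)]. *)
have : (ramsey r (double_star n n) <= (2 * r - 1) * (n + 1) - 1)%N.
  rewrite /ramsey; case: ex_minnP => m _; apply.
  by apply: forces_mono_double_star => //; nia.
rewrite -(ler_nat rat) => /le_trans; apply.
rewrite natrB ?natrM ?natrB ?natrM ?natrD; [lra | nia | nia].
Qed.
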